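(* Let $k$ be a field of characteristic zero. The differential algebra $D_2 = k_{+}\{x\}/[x^2]$ is prime, i.e. for any two nonzero differential ideals $A,B$ of $D_2$ one has $AB\neq 0$.
   Context: $k\{x\}$ denotes the differential polynomial algebra in one indeterminate: the polynomial algebra $k[x_0,x_1,x_2,\dots]$ (with $x = x_0$) with the $k$-linear derivation satisfying $x_n' = x_{n+1}$. $k_{+}\{x\}$ is its subalgebra (without unity) of differential polynomials with zero constant term. A differential ideal is an ideal $I$ with $I'\subseteq I$; $[x^2]$ denotes the differential ideal of $k_{+}\{x\}$ generated by $x^2$, and $D_2$ carries the induced derivation. *)

(* Defs.v *)
From HB Require Import structures.
From mathcomp Require Import all_boot all_order all_algebra.
From mathcomp Require Import finmap.
From mathcomp.multinomials Require Import monalg.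
Set Implicit Arguments. Unset Strict Implicit. Unset Printing Implicit Defensive.
Import GRing.Theory.
Local Open Scope ring_scope.

(* k{x} = k[x_0, x_1, ...]: the monoid algebra over commutative monomials
   in countably many variables indexed by nat (x_n is << ucm n >>). *)
Definition dpoly (k : fieldType) := {malg k[{cmonom nat}]}.

Section DiffPoly.
Variable k : fieldType.
Local Notation P := (dpoly k).

Definition xvar (n : nat) : P := << ucm n >>.

Definition dmon (m : {cmonom nat}) : P :=
  \sum_(i <- finsupp (cmonom_val m))
     (cmonom_val m i)%:R *: << mulcm (divcm m (ucm i)) (ucm i.+1) >>.

(* the k-linear derivation of k{x} with x_n' = x_{n+1} *)
Definition dderiv (g : P) : P := \sum_(m <- msupp g) g@_m *: dmon m.

Definition kplus (g : P) : Prop := g@_(@onecm nat) = 0.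

(* differential ideal of the non-unital k-algebra k_+{x} *)
Definition diff_ideal (I : P -> Prop) : Prop :=
  (forall g, I g -> kplus g) /\
  [/\ I 0,
      forall f g, I f -> I g -> I (f + g),
      forall (c : k) f, I f -> I (c *: f),
      forall f g, kplus f -> I g -> I (f * g)
    & forall f, I f -> I (dderiv f)].

Definition X2 (g : P) : Prop :=
  forall I, diff_ideal I -> I (xvar 0 ^+ 2) -> I g.

End DiffPoly.

(* Main.v *)
Require Import Defs.
From HB Require Import structures.
From mathcomp Require Import all_boot all_order all_algebra.
From mathcomp Require Import finmap.
From mathcomp.multinomials Require Import monalg.
From mathcomp Require Import ring.
From Stdlib Require Import Classical_Prop.

(* Let x(z) = sum_i x_i z^i / i!, so that x(z)^2 = sum_n q_n z^n, and let J be the ideal spanned by the q_n.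
   Suppose that a b^(n) lies in J for all n, and that a does not. The endomorphism sigma : x(z) |-> z x(z)
   preserves J and sends every element to a constant after finitely many steps, so replacing a by
   sigma^l a (and each b^(n) by sigma^l b^(n)) one may assume that either a is a nonzero constant or
   sigma a lies in J. In the latter case a = x_0 a' modulo J, and the key fact
       x_0 g in J  ==>  sigma^2 g in J
   lets one replace a by sigma^2 a', of smaller degree and still outside J. So sigma^m b^(n) lies in J for
   all n and some m. The substitutions x(z) |-> (z - c)^m x(z) intertwine the derivation D with D - d/dc,
   hence (z - c)^m x(z) maps b into J[c]; since z - 1 is invertible as a power series, b lies in J.
   For the key fact, the operator
       gam_p : x(z_1)...x(z_n) |-> sum_j p(z_j) prod_(i <> j) (z_i - z_j)^2 x(z_i)
   preserves J because of the double zeros, and satisfies gam_1 (x_0 g) = sigma^2 g + x_0 gam_(z^2) g. *)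
Set Implicit Arguments. Unset Strict Implicit. Unset Printing Implicit Defensive.
Import GRing.Theory.
Local Open Scope fset_scope.
Local Open Scope ring_scope.

Section PreMul.
Variables (R : nzRingType) (V : zmodType) (psi : nat -> {additive R -> V}) (h : R).

(** The maps [psi i] are only additive, so a Leibniz factor [h] cannot be taken out of them and is
    kept in the argument. *)
Definition premul (i : nat) (g : R) : V := psi i (h * g).

Lemma premul_additive i : additive (premul i).
Proof. by move=> f g; rewrite /premul mulrBr raddfB. Qed.

HB.instance Definition _ i :=
  GRing.isZmodMorphism.Build R V (premul i) (premul_additive i).
End PreMul.

Lemma natr_neq0 (k : fieldType) (char0 : [pchar k] =i pred0) n : n.+1%:R != 0 :> k.
Proof. by have /pcharf0P -> := char0. Qed.

(** * The free commutative algebra [k{x}] *)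

Section CommMonomEval.
Variables (S : comNzRingType) (v : nat -> S).

Definition ceval (m : {cmonom nat}) : S := \prod_(i <- finsupp m) v i ^+ m i.

Lemma cevalEw (m : {cmonom nat}) (d : {fset nat}) : finsupp m `<=` d ->
  ceval m = \prod_(i <- d) v i ^+ m i.
Proof.
move=> le; rewrite /ceval (big_fset_incl _ le) // => i _.
by rewrite -cmE_neq0 negbK => /eqP ->; rewrite expr0.
Qed.

Lemma ceval_mmorphism : mmorphism ceval.
Proof.
split=> [m1 m2|]; last by rewrite /ceval mdom1 big_seq_fset0.
rewrite (@cevalEw (mmul m1 m2) (finsupp m1 `|` finsupp m2)) ?mdomD ?fsubset_refl //.
rewrite (cevalEw (fsubsetUl (finsupp m1) (finsupp m2))).
rewrite (cevalEw (fsubsetUr (finsupp m1) (finsupp m2))).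
by rewrite -big_split /=; apply: eq_bigr => i _; rewrite cmM exprD.
Qed.

HB.instance Definition _ := isMultiplicative.Build {cmonom nat} S ceval ceval_mmorphism.

Lemma cevalU i : ceval (ucm i) = v i.
Proof. by rewrite /ceval mdomU big_seq_fset1 cmUU expr1. Qed.

End CommMonomEval.

Section DPoly.
Variable k : fieldType.
Hypothesis char0 : [pchar k] =i pred0.
Local Notation P := {malg k[{cmonom nat}]}.

Lemma factr_neq0 n : (n`!)%:R != 0 :> k.
Proof. by rewrite -(prednK (fact_gt0 n)) (natr_neq0 char0). Qed.

(* The variables are rescaled as [x_i / i!]: the [yv i] are the Taylor coefficients of the generic arc. *)
Definition yv (i : nat) : P := (i`!%:R)^-1 *: << ucm i >>.

Lemma xvarE i : << ucm i >> = i`!%:R *: yv i :> P.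
Proof. by rewrite /yv scalerA divff ?factr_neq0 // scale1r. Qed.

Lemma malgUMU (c d : k) (m n : {cmonom nat}) :
  << c *g m >> * << d *g n >> = << c * d *g mmul m n >> :> P.
Proof. by rewrite (malgMEw msuppU_le msuppU_le) !big_seq_fset1 !mcoeffUU. Qed.

Lemma malgZU (c d : k) (m : {cmonom nat}) : c *: << d *g m >> = << c * d *g m >> :> P.
Proof. by rewrite -mul_malgC malgUMU mul1m. Qed.

Lemma dpoly_ind (Q : P -> Prop) :
  (forall c, Q c%:MP) -> (forall f g, Q f -> Q g -> Q (f + g)) ->
  (forall i f, Q f -> Q (yv i * f)) -> forall g, Q g.
Proof.
move=> QC QD QM g; rewrite (@monalgE _ _ g).
elim/big_ind: _ => [||m _]; [by rewrite -(@malgC0E _ _); exact: QC|exact: QD|].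
move: (g@_m) => c; move: (leqnn (mdeg m)); move: {2}(mdeg m) => n.
elim: n m c => [|n IH] m c.
  by rewrite leqn0 mdeg_eq0 => /eqP ->; exact: QC.
move=> lemn; have [->|nm1] := eqVneq m mone; first exact: QC.
have /fset0Pn [i im] : finsupp m != fset0.
  apply: contraNneq nm1 => m0; rewrite -mdeg_eq0 mdegE m0 big_seq_fset0 //.
have mE : m = mmul (ucm i) (divcm m (ucm i)).
  apply/eqP/cmP => j; rewrite cmM cmU divcmE cmU.
  have [<-|_] := eqVneq i j; last by rewrite add0n subn0.
  by rewrite subnKC // lt0n cmE_neq0.
rewrite mE -[c]mulr1 mulrC -malgUMU xvarE -scalerAl scalerAr malgZU.
apply/QM/IH; rewrite -ltnS; apply: leq_trans lemn.
by rewrite {2}mE mdegM mdegU.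
Qed.

Section Subst.
Variables (S : comNzRingType) (phi : {rmorphism k -> S}) (v : nat -> S).

Definition dsubst (g : P) : S := mmap phi (ceval (fun i => phi i`!%:R * v i)) g.

Lemma dsubst_is_additive : additive dsubst.
Proof. exact: mmap_is_additive. Qed.

Lemma dsubst_is_monoid_morphism : monoid_morphism dsubst.
Proof. by have [SM S1] := @mmap_is_multiplicative _ _ _ phi (ceval (fun i => phi i`!%:R * v i)). Qed.

HB.instance Definition _ := GRing.isZmodMorphism.Build P S dsubst dsubst_is_additive.
HB.instance Definition _ := GRing.isMonoidMorphism.Build P S dsubst dsubst_is_monoid_morphism.

Lemma dsubstC c : dsubst c%:MP = phi c.
Proof. exact: mmapC. Qed.

Lemma dsubstY i : dsubst (yv i) = v i.
Proof.
rewrite /dsubst /yv malgZU mmapU mulr1 cevalU mulrA -rmorphM mulVf ?factr_neq0 //.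
by rewrite rmorph1 mul1r.
Qed.
End Subst.

(** * First-order operators in the rescaled variables *)

Section GDer.
Variable V : zmodType.
Implicit Type psi : nat -> {additive P -> V}.

(** By the rescaling, the derivative of a monomial [m] in [y_i] is [i! m_i] times [m / x_i]. *)
Definition gdm psi (c : k) (m : {cmonom nat}) : V :=
  \sum_(i <- finsupp m) psi i << c *g divcm m (ucm i) >> *+ (m i * i`!).

Lemma gdmEw psi c (m : {cmonom nat}) (d : {fset nat}) : finsupp m `<=` d ->
  gdm psi c m = \sum_(i <- d) psi i << c *g divcm m (ucm i) >> *+ (m i * i`!).
Proof.
move=> le; rewrite /gdm (big_fset_incl _ le) // => i _.
by rewrite -cmE_neq0 negbK => /eqP ->; rewrite mulr0n.
Qed.

Definition gder psi (g : P) : V := \sum_(m <- msupp g) gdm psi g@_m m.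

Lemma gdm_additive psi m : additive (gdm psi ^~ m).
Proof.
move=> c d; rewrite /gdm -sumrB; apply: eq_bigr => i _.
by rewrite monalgUB raddfB mulrnBl.
Qed.

Lemma gderEw psi (g : P) (d : {fset {cmonom nat}}) : msupp g `<=` d ->
  gder psi g = \sum_(m <- d) gdm psi g@_m m.
Proof.
move=> le; rewrite /gder (big_fset_incl _ le) // => m _ /mcoeff_outdom ->.
by rewrite -[X in gdm _ X](subrr 0) gdm_additive subrr.
Qed.

Lemma gder_additive psi : additive (gder psi).
Proof.
move=> f g; rewrite (@gderEw psi (f - g) (msupp f `|` msupp g)) ?msuppB_le //.
rewrite (@gderEw psi f (msupp f `|` msupp g)) ?fsubsetUl //.
rewrite (@gderEw psi g (msupp f `|` msupp g)) ?fsubsetUr //.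
by rewrite -sumrB; apply: eq_bigr => m _; rewrite raddfB gdm_additive.
Qed.

HB.instance Definition _ psi := GRing.isZmodMorphism.Build P V (gder psi) (gder_additive psi).

Lemma gderU psi c m : gder psi << c *g m >> = gdm psi c m.
Proof. by rewrite (gderEw _ msuppU_le) big_seq_fset1 mcoeffUU. Qed.

Lemma gderC psi c : gder psi c%:MP = 0.
Proof. by rewrite gderU /gdm mdom1 big_seq_fset0. Qed.

Lemma sum_fset_shift (d : {fset nat}) j (F1 F2 : nat -> V) x :
  j \in d -> F1 j = x + F2 j -> (forall i, i != j -> F1 i = F2 i) ->
  \sum_(i <- d) F1 i = x + \sum_(i <- d) F2 i.
Proof.
move=> jd Fj Fi; rewrite (big_fsetD1 j jd) [in RHS](big_fsetD1 j jd) /= Fj addrA.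
by congr (_ + _); rewrite !big_seq; apply: eq_bigr => i; rewrite !inE => /andP[/Fi].
Qed.

(** Equality of the terms is asked only for [0 < q]: when [x_j] does not divide [m],
    [divcm m (ucm j)] is not a true quotient, but it occurs with multiplicity zero. *)
Lemma mulrn_split (x y z : V) p q : x *+ p = y -> (0 < q -> x = z)%N ->
  x *+ (p + q * p) = y + z *+ (q * p).
Proof. by case: q => [|q] xy xz; rewrite mulrnDr xy ?mul0n // xz. Qed.

Lemma gderY psi j f : gder psi (yv j * f) = psi j f + gder (premul psi (yv j)) f.
Proof.
rewrite (@monalgE _ _ f) mulr_sumr !raddf_sum /= -big_split /=; apply: eq_bigr => m _.
move: (f@_m) => c; rewrite !gderU /yv malgZU malgUMU mulr1 gderU.
set b := _^-1; set M := mmul _ m.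
have sm : finsupp m `<=` finsupp M by rewrite mdomD fsubsetUr.
rewrite (gdmEw _ _ sm) /gdm.
have jM : j \in finsupp M by rewrite -cmE_neq0 cmM cmUU.
apply: (sum_fset_shift jM) => [|i nij].
  have -> : divcm M (ucm j) = m.
    by apply/eqP/cmP => i; rewrite divcmE cmM addKn.
  have -> : (M j * j`! = j`! + m j * j`!)%N by rewrite cmM cmUU mulSn.
  apply: mulrn_split.
    rewrite -raddfMn -monalgUMn.
    by have -> : (b * c) *+ j`! = c by rewrite -mulr_natl mulrA divff ?mul1r ?factr_neq0.
  move=> mj; rewrite /= /premul malgUMU.
  have -> // : mmul (ucm j) (divcm m (ucm j)) = m.
  apply/eqP/cmP => i; rewrite cmM divcmE cmU.
  by have [<-|_] := eqVneq j i; rewrite ?subn0 // subnKC.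
have -> : M i = m i by rewrite cmM cmU eq_sym (negPf nij).
rewrite /= /premul malgUMU.
have -> // : divcm M (ucm i) = mmul (ucm j) (divcm m (ucm i)).
apply/eqP/cmP => l.
rewrite cmM !divcmE !cmM !cmU.
have [il|_] := eqVneq i l; last by rewrite !subn0.
by rewrite -il eq_sym (negPf nij) add0n.
Qed.

End GDer.
End DPoly.
(** * The ideal of [x(z)^2] *)

Definition sh (V : zmodType) (u : nat -> V) (i : nat) : V := if i is j.+1 then u j else 0.

(** * Coefficients of products of power series *)

Section Convolution.
Variable S : comNzRingType.
Implicit Types u v : nat -> S.

Definition conv u v n := \sum_(i < n.+1) u i * v (n - i)%N.

Lemma convC u v n : conv u v n = conv v u n.
Proof.
rewrite /conv (reindex_inj rev_ord_inj) /=; apply: eq_bigr => i _.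
by rewrite subSS subKn ?leq_ord // mulrC.
Qed.

Lemma conv_shl u v n : conv (sh u) v n = sh (conv u v) n.
Proof.
case: n => [|n]; first by rewrite /conv big_ord1 mul0r.
by rewrite /conv big_ord_recl mul0r add0r.
Qed.

Lemma conv_shr u v n : conv u (sh v) n = sh (conv u v) n.
Proof.
by rewrite convC conv_shl; case: n => //= n; rewrite convC.
Qed.

Lemma convBl u1 u2 v n : conv (fun i => u1 i - u2 i) v n = conv u1 v n - conv u2 v n.
Proof. by rewrite -sumrB; apply: eq_bigr => i _; rewrite mulrBl. Qed.

Lemma convBr u v1 v2 n : conv u (fun i => v1 i - v2 i) n = conv u v1 n - conv u v2 n.
Proof. by rewrite convC convBl ![conv _ u n]convC. Qed.

Lemma convMl c u v n : conv (fun i => u i * c) v n = conv u v n * c.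
Proof. by rewrite /conv mulr_suml; apply: eq_bigr => i _; rewrite mulrAC. Qed.

Lemma convMr c u v n : conv u (fun i => v i * c) n = conv u v n * c.
Proof. by rewrite convC convMl convC. Qed.

Lemma eq_conv u1 u2 v1 v2 n : u1 =1 u2 -> v1 =1 v2 -> conv u1 v1 n = conv u2 v2 n.
Proof. by move=> eu ev; apply: eq_bigr => i _; rewrite eu ev. Qed.

(** This is [((z - c) u)^2 = (z^2 - 2 c z + c^2) u^2] on coefficients. *)
Lemma conv_sh_sub (c : S) u n :
  conv (fun i => sh u i - u i * c) (fun i => sh u i - u i * c) n =
  sh (sh (conv u u)) n - sh (conv u u) n * c *+ 2 + conv u u n * c ^+ 2.
Proof.
rewrite convBl !convBr !convMl !convMr conv_shl !conv_shr conv_shl.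
have -> : sh (conv u (sh u)) n = sh (sh (conv u u)) n.
  by case: n => //= n; rewrite conv_shr.
ring.
Qed.

Lemma conv_succ u n :
  conv (u \o succn) (u \o succn) n = conv u u n.+2 - u 0%N * u n.+2 *+ 2.
Proof.
rewrite {2}/conv big_ord_recl big_ord_recr /= subn0 subnn.
have -> : \sum_(i < n.+1) u (lift ord0 (widen_ord (leqnSn n.+1) i)) *
            u (n.+2 - lift ord0 (widen_ord (leqnSn n.+1) i))%N = conv (u \o succn) (u \o succn) n.
  by apply: eq_bigr => i _ /=; rewrite /bump /= add1n subSS subSn // -ltnS.
rewrite /bump /= add1n; ring.
Qed.

Lemma conv_derive u n :
  conv (fun i => u i.+1 *+ i.+1) u n + conv u (fun i => u i.+1 *+ i.+1) n
  = conv u u n.+1 *+ n.+1.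
Proof.
have -> : conv u u n.+1 *+ n.+1 = \sum_(i < n.+2) u i *+ i * u (n.+1 - i)%N
    + \sum_(i < n.+2) u i * (u (n.+1 - i)%N *+ (n.+1 - i)).
  rewrite -sumrMnl -big_split /=; apply: eq_bigr => i _.
  by rewrite mulrnAr mulrnAl -mulrnDr subnKC // -ltnS.
rewrite [in RHS]big_ord_recl mulr0n mul0r add0r.
rewrite [X in _ = _ + X]big_ord_recr /= subnn mulr0n mulr0 addr0.
by congr (_ + _); apply: eq_bigr => i _ /=; rewrite subSn // -ltnS.
Qed.

End Convolution.

(** With [w(s)] the series of the [w i] and [c] for ['X], the sum sets [s = c] in
    [r(c) (s - c) w(s)], which vanishes there. *)
Lemma sum_coef_telescope (S : nzRingType) (r : {poly S}) (w : nat -> {poly S}) n :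
  \sum_(i < n.+1) (r * (sh w (n - i)%N - w (n - i)%N * 'X))`_i = 0.
Proof.
under eq_bigr do rewrite mulrBr coefB mulrA coefMX.
rewrite sumrB [X in X - _]big_ord_recr [X in _ - X]big_ord_recl /= subnn mulr0 coef0 addr0 add0r.
apply/eqP; rewrite subr_eq0; apply/eqP; apply: eq_bigr => i _ /=.
have -> : (n - i = (n - i.+1).+1)%N by rewrite subnSK.
by [].
Qed.

(* [P] stands for the polynomial ring [k[y 0, y 1, ...]], and [gder psi] for the additive map
   [g |-> sum_i psi i (dg/dy_i)]. *)
Section FreeDifferential.
Variables (k : fieldType) (P : comNzRingType) (iota : {rmorphism k -> P}) (y : nat -> P).
Hypothesis char0 : [pchar k] =i pred0.
Hypothesis P_ind : forall Q : P -> Prop,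
  (forall c, Q (iota c)) -> (forall f g, Q f -> Q g -> Q (f + g)) ->
  (forall i f, Q f -> Q (y i * f)) -> forall g, Q g.
Variable lift : forall (S : comNzRingType), {rmorphism k -> S} -> (nat -> S) -> {rmorphism P -> S}.
Hypothesis liftC : forall S phi v c, @lift S phi v (iota c) = phi c.
Hypothesis liftY : forall S phi v i, @lift S phi v (y i) = v i.
Variable gder : (nat -> {additive P -> P}) -> {additive P -> P}.
Hypothesis gderC : forall psi c, gder psi (iota c) = 0.
Hypothesis gderY : forall psi j f,
  gder psi (y j * f) = psi j f + gder (premul psi (y j)) f.

Lemma rmorph_ext (S : comNzRingType) (f g : {rmorphism P -> S}) :
  (forall c, f (iota c) = g (iota c)) -> (forall i, f (y i) = g (y i)) -> f =1 g.
Proof.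
move=> eC eY; apply: P_ind => [//|a b ea eb|i a ea]; first by rewrite !rmorphD ea eb.
by rewrite !rmorphM eY ea.
Qed.

Lemma eq_gder (psi1 psi2 : nat -> {additive P -> P}) :
  (forall i, psi1 i =1 psi2 i) -> gder psi1 =1 gder psi2.
Proof.
move=> e g; move: g psi1 psi2 e; apply: P_ind => [c|f g IHf IHg|i f IH] psi1 psi2 e.
- by rewrite !gderC.
- by rewrite !raddfD /= (IHf _ _ e) (IHg _ _ e).
- rewrite !gderY e; congr (_ + _); apply: IH => j h; exact: e.
Qed.

Lemma gderM psi f g :
  gder psi (f * g) = gder (premul psi g) f + gder (premul psi f) g.
Proof.
move: f psi; apply: P_ind => [c|f1 f2 IH1 IH2|i f IH] psi.
- rewrite gderC add0r.
  move: g psi; apply: P_ind => [d|f1 f2 IH1 IH2|i f IH] psi.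
  + by rewrite -rmorphM !gderC.
  + by rewrite mulrDr !raddfD /= IH1 IH2.
  + rewrite mulrCA !gderY IH; congr (_ + _); apply: eq_gder => j h.
    by rewrite /= /premul /= /premul mulrCA.
- rewrite mulrDl !raddfD /= IH1 IH2 addrACA; congr (_ + _).
  (* Additivity of [gder] in [psi] is not given, so it is proved here by induction on [g]. *)
  move: g psi {IH1 IH2}; apply: P_ind => [d|g1 g2 IH1 IH2|i g IH] psi.
  + by rewrite !gderC addr0.
  + by rewrite !raddfD /= -IH1 -IH2 addrACA.
  + rewrite !gderY addrACA /= /premul mulrDl raddfD; congr (_ + _).
    rewrite -[RHS](@eq_gder (premul (premul psi (y i)) (f1 + f2))) -?IH //.
      by congr (_ + _); apply: eq_gder => j h; rewrite /= /premul /= /premul mulrCA.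
    by move=> j h; rewrite /= /premul /= /premul mulrCA.
- rewrite -mulrA !gderY IH addrA; congr (_ + _).
    congr (_ + _); first by rewrite /= /premul /= /premul mulrC.
    by apply: eq_gder => j h; rewrite /= /premul /= /premul mulrCA.
  by apply: eq_gder => j h; rewrite /= /premul /= /premul mulrA.
Qed.

(** * The ideal of the coefficients of [x(z)^2] *)

Definition q n : P := conv y y n.

(* Up to factorials, the [q n] are the derivatives of [x^2]. *)
Inductive J : P -> Prop :=
| J0 : J 0
| Jcons f n g : J g -> J (f * q n + g).

Lemma Jq f n : J (f * q n).
Proof. by rewrite -[_ * _]addr0; apply/Jcons/J0. Qed.

Lemma JD f g : J f -> J g -> J (f + g).
Proof. by elim=> [|h n f' _ IH] Jg; rewrite ?add0r // -addrA; apply/Jcons/IH. Qed.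

Lemma JM f g : J g -> J (f * g).
Proof.
elim=> [|h n g' _ IH]; first by rewrite mulr0; exact: J0.
by rewrite mulrDr mulrA; apply: Jcons.
Qed.

Lemma JN g : J g -> J (- g).
Proof. by rewrite -mulN1r; exact: JM. Qed.

Lemma JB f g : J f -> J g -> J (f - g).
Proof. by move=> Jf /JN; exact: JD. Qed.

Lemma J_sum I (r : seq I) (Q : pred I) (F : I -> P) :
  (forall i, Q i -> J (F i)) -> J (\sum_(i <- r | Q i) F i).
Proof. by move=> JF; apply: big_ind => //; [exact: J0|exact: JD]. Qed.

Lemma JMn g n : J g -> J (g *+ n).
Proof. by rewrite -mulr_natl; exact: JM. Qed.

Lemma JC c g : c != 0 -> J (iota c * g) -> J g.
Proof.
by move=> c0 /(JM (iota c^-1)); rewrite mulrA -rmorphM mulVf // rmorph1 mul1r.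
Qed.

Lemma JMn_inv g n : J (g *+ n.+1) -> J g.
Proof.
by rewrite -mulr_natl -(rmorph_nat iota); apply: JC; exact: (natr_neq0 char0).
Qed.

Lemma Jsh (u : nat -> P) n : (forall i, J (u i)) -> J (sh u n).
Proof. by case: n => [|n] Ju /=; [exact: J0|]. Qed.

Lemma rmorph_q (S : comNzRingType) (f : {rmorphism P -> S}) n :
  f (q n) = conv (f \o y) (f \o y) n.
Proof. by rewrite rmorph_sum; apply: eq_bigr => i _; rewrite rmorphM. Qed.

Lemma J_rmorph (f : {rmorphism P -> P}) g : (forall n, J (f (q n))) -> J g -> J (f g).
Proof.
move=> Jf; elim=> [|h n g' _ IH]; first by rewrite rmorph0; exact: J0.
by rewrite rmorphD rmorphM; apply: JD => //; apply: JM.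
Qed.

Definition JX (p : {poly P}) := forall i, J p`_i.

Lemma JXD p r : JX p -> JX r -> JX (p + r).
Proof. by move=> Jp Jr i; rewrite coefD; apply: JD. Qed.

Lemma JXM p r : JX r -> JX (p * r).
Proof. by move=> Jr i; rewrite coefM; apply: J_sum => j _; apply: JM. Qed.

Lemma JXN p : JX p -> JX (- p).
Proof. by move=> Jp i; rewrite coefN; apply: JN. Qed.

Lemma JXC f : J f -> JX f%:P.
Proof. by move=> Jf i; rewrite coefC; case: eqP => _ //; exact: J0. Qed.

Lemma JX_rmorph (f : {rmorphism P -> {poly P}}) g :
  (forall n, JX (f (q n))) -> J g -> JX (f g).
Proof.
move=> Jf; elim=> [|h n g' _ IH]; first by rewrite rmorph0 => i; rewrite coef0; exact: J0.
by rewrite rmorphD rmorphM; apply: JXD => //; apply: JXM.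
Qed.

(* [x(z) |-> z x(z)] *)
Definition sigma : {rmorphism P -> P} := lift iota (sh y).

Lemma J_sigma g : J g -> J (sigma g).
Proof.
apply: J_rmorph => n; rewrite rmorph_q (@eq_conv _ _ (sh y) _ (sh y)); try exact: liftY.
rewrite conv_shl; case: n => [|n]; first exact: J0.
by rewrite /= conv_shr; apply: Jsh => i; rewrite -[conv _ _ _]mul1r; exact: Jq.
Qed.

Lemma Jqn n : J (q n).
Proof. by rewrite -[q n]mul1r; exact: Jq. Qed.

(* [x(z) |-> (z - 1) x(z)], with inverse [tau] *)
Definition sigma1 : {rmorphism P -> P} := lift iota (fun i => sh y i - y i).
Definition tau : {rmorphism P -> P} := lift iota (fun i => - \sum_(j < i.+1) y j).

(** Multiplying by [1 / (z - 1)] takes negated partial sums of the coefficients, whose successive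
    differences give the coefficients back. *)
Lemma tauK : cancel sigma1 tau.
Proof.
move=> g; rewrite -[RHS]/(idfun g) -[LHS]/((tau \o sigma1) g); move: g.
apply: rmorph_ext => [c|i] /=; first by rewrite !liftC.
rewrite liftY rmorphB liftY big_ord_recr /=.
by case: i => [|i] /=; rewrite ?rmorph0 ?liftY ?big_ord0 opprK; ring.
Qed.

Lemma sigma1_q n : sigma1 (q n) = sh (sh q) n - sh q n *+ 2 + q n.
Proof.
rewrite rmorph_q (@eq_conv _ _ (fun i => sh y i - y i * 1) _ (fun i => sh y i - y i * 1));
  try by move=> i; rewrite /= liftY mulr1.
by rewrite conv_sh_sub mulr1 expr1n mulr1.
Qed.

Lemma J_tau g : J g -> J (tau g).
Proof.
apply: J_rmorph; elim/ltn_ind => n IH.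
(* Applying [tau] to [sigma1_q] expresses [tau (q n)] through [q n] and the images of earlier
   coefficients. *)
have -> : tau (q n) = q n - (tau (sh (sh q) n) - tau (sh q n) *+ 2).
  rewrite -{2}(tauK (q n)) sigma1_q !(rmorphD, rmorphB, rmorphMn) /=; ring.
apply/JB/JB; [exact: Jqn| |apply: JMn].
  by case: n IH => [|[|n]] IH /=; rewrite ?rmorph0; try exact: J0; exact: IH.
by case: n IH => [|n] IH /=; rewrite ?rmorph0; try exact: J0; exact: IH.
Qed.

Lemma J_sigma1 g : J (sigma1 g) -> J g.
Proof. by move/J_tau; rewrite tauK. Qed.

(* [x(z) |-> (z - c) x(z)] where [c] is the polynomial variable; [Sc] is its [c]-linear extension. *)
Definition sc : {rmorphism P -> {poly P}} :=
  lift (polyC \o iota) (fun i => sh (polyC \o y) i - (y i)%:P * 'X).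
Definition Sc : {rmorphism {poly P} -> {poly P}} := horner_eval 'X \o map_poly sc.

Lemma ScC f : Sc f%:P = sc f.
Proof. by rewrite /= map_polyC /= /horner_eval hornerC. Qed.

Lemma ScX : Sc 'X = 'X.
Proof. by rewrite /= map_polyX /horner_eval hornerX. Qed.

Lemma Sc_sum p : Sc p = \sum_(i < size p) sc p`_i * 'X^i.
Proof.
rewrite -{1}[p]coefK poly_def rmorph_sum; apply: eq_bigr => i _.
by rewrite -mul_polyC rmorphM rmorphXn ScC ScX.
Qed.

Lemma sc_y i : sc (y i) = sh (polyC \o y) i - (y i)%:P * 'X.
Proof. exact: liftY. Qed.

Lemma shC i : sh (polyC \o y) i = (sh y i)%:P.
Proof. by case: i. Qed.

Lemma sc_q n : JX (sc (q n)).
Proof.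
rewrite rmorph_q (@eq_conv _ _ (fun i => sh (polyC \o y) i - (y i)%:P * 'X) _
  (fun i => sh (polyC \o y) i - (y i)%:P * 'X)); try exact: sc_y.
have E m : conv (polyC \o y) (polyC \o y) m = (q m)%:P.
  by rewrite /q /conv rmorph_sum; apply: eq_bigr => i _; rewrite rmorphM.
have JE m : JX (conv (polyC \o y) (polyC \o y) m) by rewrite E; apply/JXC/Jqn.
have J0X : JX 0 by move=> i; rewrite coef0; exact: J0.
rewrite (conv_sh_sub 'X (polyC \o y) n); apply: JXD; last by rewrite mulrC; apply: JXM.
apply: JXD; first by case: n => [|[|n]] //=.
apply: JXN; rewrite mulr2n; apply: JXD; rewrite mulrC; apply: JXM; by case: n.
Qed.

Lemma J_sc g : J g -> JX (sc g).
Proof. exact: JX_rmorph sc_q. Qed.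

Lemma JX_Sc p : JX p -> JX (Sc p).
Proof.
move=> Jp; rewrite Sc_sum => i; rewrite coef_sum; apply: J_sum => j _.
by rewrite mulrC; apply: JXM; apply: J_sc.
Qed.

(** * The derivation [D], which acts on [x(z)] as [d/dz] *)

Definition dpsi (i : nat) (f : P) : P := y i.+1 * f *+ i.+1.

Lemma dpsi_additive i : additive (dpsi i).
Proof. by move=> f g; rewrite /dpsi mulrBr mulrnBl. Qed.

HB.instance Definition _ i := GRing.isZmodMorphism.Build P P (dpsi i) (dpsi_additive i).

Definition D : {additive P -> P} := gder dpsi.

Lemma D_const c : D (iota c) = 0.
Proof. exact: gderC. Qed.

(** The maps [dpsi i] are [P]-linear, so here the factor does come out. *)
Lemma premul_dpsi h g : gder (premul dpsi h) g = h * D g.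
Proof.
move: g h; apply: P_ind => [c|f g IHf IHg|i f IH] h.
- by rewrite D_const gderC mulr0.
- by rewrite !raddfD /= IHf IHg mulrDr.
- rewrite /D !gderY IH (@eq_gder _ (premul dpsi (h * y i))).
    by rewrite IH /= /premul /= /dpsi; ring.
  by move=> j g; rewrite /= /premul /= /premul mulrA.
Qed.

Lemma D_mul f g : D (f * g) = D f * g + f * D g.
Proof. by rewrite [LHS]gderM !premul_dpsi; ring. Qed.

Lemma D_y i : D (y i) = y i.+1 *+ i.+1.
Proof.
rewrite -[y i]mulr1 /D gderY -(rmorph1 iota) gderC addr0 /= /dpsi.
by rewrite rmorph1 mulr1.
Qed.

Lemma D_q n : D (q n) = q n.+1 *+ n.+1.
Proof.
rewrite /q -conv_derive raddf_sum /conv -big_split /=; apply: eq_bigr => i _.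
by rewrite D_mul !D_y.
Qed.

Lemma J_D g : J g -> J (D g).
Proof.
elim=> [|f n g' _ IH]; first by rewrite raddf0; exact: J0.
rewrite raddfD /= D_mul D_q; apply/JD/IH/JD; first exact: Jq.
exact/JM/JMn/Jqn.
Qed.

(* [d/dt - d/dc] on polynomials in [c], where [d/dt] is [D] acting on the coefficients *)
Definition nabla (p : {poly P}) : {poly P} := map_poly D p - p^`().

Lemma nabla_additive : additive nabla.
Proof. by move=> p r; rewrite /nabla !raddfB /=; ring. Qed.

HB.instance Definition _ := GRing.isZmodMorphism.Build {poly P} {poly P} nabla nabla_additive.

Lemma nabla_mul p r : nabla (p * r) = nabla p * r + p * nabla r.
Proof.
have E : map_poly D (p * r) = map_poly D p * r + p * map_poly D r.
  apply/polyP => i; rewrite coefD coef_map /= !coefM raddf_sum -big_split /=.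
  by apply: eq_bigr => j _; rewrite D_mul !coef_map.
rewrite /nabla E derivM; ring.
Qed.

Lemma nablaC f : nabla f%:P = (D f)%:P.
Proof. by rewrite /nabla map_polyC derivC subr0. Qed.

Lemma nablaX : nabla 'X = -1.
Proof.
rewrite /nabla derivX; have -> : map_poly D 'X = 0; last by rewrite sub0r.
apply/polyP => i; rewrite coef_map coefX coef0 /=.
by case: eqP => _; rewrite ?raddf0 // -(rmorph1 iota) D_const.
Qed.

(** Since [D] acts on [x(z)] as [d/dz], the left side gives [(z - c) x'(z) + x(z)]; the last term is
    minus the [c]-derivative of [(z - c) x(z)]. *)
Lemma sc_D g : sc (D g) = nabla (sc g).
Proof.
apply: (P_ind (Q := fun g => sc (D g) = nabla (sc g))) => [c|f h IHf IHh|i f IH].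
- by rewrite D_const rmorph0 liftC /= nablaC D_const.
- by rewrite !raddfD /= IHf IHh.
rewrite D_mul !(rmorphD, rmorphM) /= nabla_mul IH; congr (_ * _ + _).
rewrite D_y rmorphMn /= !sc_y raddfB /= nabla_mul nablaX shC !nablaC /= !D_y.
rewrite rmorphMn; case: i => [|i] /=; first by rewrite raddf0; ring.
by rewrite D_y rmorphMn /=; ring.
Qed.

Lemma Sc_nabla p : Sc (nabla p) = nabla (Sc p).
Proof.
elim/poly_ind: p => [|p c IH]; first by rewrite !raddf0.
have nD r1 r2 : nabla (r1 + r2) = nabla r1 + nabla r2 by exact: raddfD.
rewrite nD nabla_mul nablaX nablaC mulrN1 rmorphD rmorphB rmorphM.
rewrite [in RHS]rmorphD [in RHS]rmorphM ScX !ScC nD nabla_mul nablaX mulrN1.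
by rewrite IH sc_D.
Qed.

(** The image of [g] under [x(z) |-> (z - c)^m x(z)]. *)
Definition H m (g : P) : {poly P} := iter m Sc g%:P.

Lemma HS m g : H m.+1 g = Sc (H m g).
Proof. by []. Qed.

Lemma H_D m g : H m (D g) = nabla (H m g).
Proof. by elim: m => [|m IH]; [rewrite [RHS]nablaC | rewrite !HS IH Sc_nabla]. Qed.

Lemma horner_Sc (x : P) (f : {rmorphism P -> P}) :
  (forall g, (sc g).[x] = f g) -> f x = x -> forall p, (Sc p).[x] = f p.[x].
Proof.
move=> scx fx; elim/poly_ind => [|p c IH]; first by rewrite rmorph0 !horner0 rmorph0.
by rewrite rmorphD rmorphM ScX ScC !hornerMXaddC hornerD hornerM hornerX IH scx rmorphD rmorphM fx.
Qed.

Lemma sc_horner (x : P) (f : {rmorphism P -> P}) :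
  (forall c, f (iota c) = iota c) -> (forall i, f (y i) = sh y i - y i * x) ->
  forall g, (sc g).[x] = f g.
Proof.
move=> fC fY g; rewrite -[LHS]/((horner_eval x \o sc) g); move: g.
apply: rmorph_ext => [c|i] /=; first by rewrite liftC fC /horner_eval /= hornerC.
by rewrite sc_y shC fY /horner_eval !hornerE.
Qed.

Lemma sigma_y i : sigma (y i) = sh y i.
Proof. exact: liftY. Qed.

Lemma sigma_const c : sigma (iota c) = iota c.
Proof. exact: liftC. Qed.

Lemma sc_horner0 g : (sc g).[0] = sigma g.
Proof. by apply: sc_horner => [c|i]; rewrite ?liftC // liftY mulr0 subr0. Qed.

Lemma sc_horner1 g : (sc g).[1] = sigma1 g.
Proof. by apply: sc_horner => [c|i]; rewrite ?liftC // liftY mulr1. Qed.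

Lemma H_horner0 m g : (H m g).[0] = iter m sigma g.
Proof.
elim: m => [|m IH]; first by rewrite hornerC.
by rewrite iterS -IH; apply: horner_Sc; [exact: sc_horner0|exact: rmorph0].
Qed.

Lemma H_horner1 m g : (H m g).[1] = iter m sigma1 g.
Proof.
elim: m => [|m IH]; first by rewrite hornerC.
by rewrite iterS -IH; apply: horner_Sc; [exact: sc_horner1|exact: rmorph1].
Qed.

(* The relation [H m (D g) = nabla (H m g)] passes from the coefficient of [c^j] to that of [c^j.+1]. *)
Lemma J_iter_sigma_D m b : (forall n, J (iter m sigma (iter n D b))) -> J b.
Proof.
move=> Jb; have {Jb} JH j n : J (H m (iter n D b))`_j.
  elim: j n => [|j IH] n; first by rewrite -horner_coef0 H_horner0.
  apply: (@JMn_inv _ j); rewrite -coef_deriv.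
  have -> : (H m (iter n D b))^`() = map_poly D (H m (iter n D b)) - H m (iter n.+1 D b).
    by rewrite iterS H_D /nabla opprB addrC subrK.
  by rewrite coefB coef_map; apply: JB => //; apply: J_D.
have : J (iter m sigma1 b).
  rewrite -H_horner1 horner_coef; apply: J_sum => i _.
  by rewrite mulrC; apply: JM; exact: (JH i 0%N).
by elim: m {JH} => // m IH /J_sigma1.
Qed.

(** * The operators [gam p] *)

Definition H2 : {rmorphism P -> {poly P}} := Sc \o sc.

Lemma H2E g : H2 g = Sc (sc g).
Proof. by []. Qed.

Lemma sc_sh i : sc (sh y i) = sh (sc \o y) i.
Proof. by case: i => [|i] //=; rewrite rmorph0. Qed.

Lemma H2_y i : H2 (y i) = sh (sc \o y) i - sc (y i) * 'X.
Proof. by rewrite H2E {1}sc_y shC rmorphB rmorphM ScX !ScC sc_sh. Qed.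

Lemma J_H2 g : J g -> JX (H2 g).
Proof. by move=> Jg; apply/JX_Sc/J_sc. Qed.

Lemma H2_coef0 g : (H2 g)`_0 = sigma (sigma g).
Proof.
rewrite -horner_coef0 H2E (horner_Sc sc_horner0) ?sc_horner0 //; exact: rmorph0.
Qed.

Section Gamma.
Variable p : {poly P}.

(** Differentiating in [y_i] replaces a factor [x(z_j)] by [z_j^i]; pairing this with the
    coefficient of [c^i] sets [c = z_j] in [p(c)] times the product of the remaining
    [(z_l - c)^2 x(z_l)]. *)
Definition gpsi (i : nat) (f : P) : P := (p * H2 f)`_i.

Lemma gpsi_additive i : additive (gpsi i).
Proof. by move=> f g; rewrite /gpsi rmorphB mulrBr coefB. Qed.

HB.instance Definition _ i := GRing.isZmodMorphism.Build P P (gpsi i) (gpsi_additive i).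

(* [x(z_1) ... x(z_n) |-> sum_j p(z_j) prod_(i != j) (z_i - z_j)^2 x(z_i)], which respects [x(z)^2 = 0]. *)
Definition gam : {additive P -> P} := gder gpsi.
End Gamma.

Lemma gam_const p c : gam p (iota c) = 0.
Proof. exact: gderC. Qed.

(** As [H2] is multiplicative, the Leibniz factor is absorbed into [p], which keeps the product rule
    within the family [gam p]. *)
Lemma premul_gpsi p h : gder (premul (gpsi p) h) =1 gam (p * H2 h).
Proof.
by apply: eq_gder => i g; rewrite /= /premul /= /gpsi rmorphM mulrA.
Qed.

Lemma gamY p j f : gam p (y j * f) = (p * H2 f)`_j + gam (p * H2 (y j)) f.
Proof. by rewrite [LHS]gderY premul_gpsi. Qed.

Lemma gam_y p j : gam p (y j) = p`_j.
Proof. by rewrite -[y j]mulr1 gamY -(rmorph1 iota) gam_const rmorph1 rmorph1 mulr1 addr0. Qed.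

Lemma gamM p f g : gam p (f * g) = gam (p * H2 g) f + gam (p * H2 f) g.
Proof. by rewrite [LHS]gderM !premul_gpsi. Qed.

Lemma gamZ c p f : gam (c%:P * p) f = c * gam p f.
Proof.
move: f p; apply: P_ind => [d|f g IHf IHg|i f IH] p; first by rewrite !gam_const mulr0.
  by rewrite !raddfD /= IHf IHg mulrDr.
by rewrite !gamY -!mulrA coefCM IH mulrDr.
Qed.

Lemma J_gam_coef p f : JX p -> J (gam p f).
Proof.
move: f p; apply: P_ind => [d|f g IHf IHg|i f IH] p Jp; first by rewrite gam_const; exact: J0.
  by rewrite raddfD; apply: JD; [exact: IHf|exact: IHg].
rewrite gamY; apply: JD; first by rewrite mulrC; apply: JXM.
by apply: IH; rewrite mulrC; apply: JXM.
Qed.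

(** On [x(s) x(t)] both terms carry the factor [(s - t)^2], which vanishes at [s = t];
    [sum_coef_telescope] is this vanishing on coefficients. *)
Lemma gam_q p n : gam p (q n) = 0.
Proof.
have E : \sum_(i < n.+1) (p * H2 (y (n - i)%N))`_i = 0.
  by rewrite -[RHS](sum_coef_telescope p (sc \o y) n); apply: eq_bigr => i _; rewrite H2_y.
rewrite /q /conv raddf_sum; under eq_bigr do rewrite /= gamY gam_y.
rewrite big_split /= E add0r -[RHS]E (reindex_inj rev_ord_inj) /=.
by apply: eq_bigr => i _; rewrite subSS subKn ?leq_ord.
Qed.

Lemma J_gam p g : J g -> J (gam p g).
Proof.
elim=> [|f n g' _ IH]; first by rewrite raddf0; exact: J0.
rewrite raddfD /= gamM gam_q addr0; apply: JD => //.
by apply: J_gam_coef; apply: JXM; apply/J_H2/Jqn.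
Qed.

(** Setting [c = 0] turns [(z - c)^2] into [z^2], whence [sigma] twice; setting [z = 0] turns it
    into [c^2], whence the weight ['X^2]. *)
Lemma gam_y0 g : gam 1 (y 0 * g) = sigma (sigma g) + y 0 * gam 'X^2 g.
Proof.
rewrite gamY !mul1r H2_coef0 H2_y sc_y /= !sub0r mulNr opprK -mulrA -expr2.
by rewrite gamZ.
Qed.

Lemma map_sigma_sc g : map_poly sigma (sc g) = sc (sigma g).
Proof.
rewrite -[LHS]/((map_poly sigma \o sc) g) -[RHS]/((sc \o sigma) g); move: g.
apply: rmorph_ext => [c|i] /=.
  by rewrite sigma_const !liftC /= map_polyC /= sigma_const.
rewrite sc_y shC rmorphB rmorphM /= map_polyX !map_polyC /= !sigma_y.
case: i => [|i] /=; first by rewrite !rmorph0 mul0r subr0.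
by rewrite sc_y shC sigma_y.
Qed.

Lemma map_sigma_Sc p : map_poly sigma (Sc p) = Sc (map_poly sigma p).
Proof.
elim/poly_ind: p => [|p c IH]; first by rewrite !rmorph0.
have ScMXaddC a b : Sc (a * 'X + b%:P) = Sc a * 'X + sc b.
  by rewrite rmorphD rmorphM ScX ScC.
have mapE a b : map_poly sigma (a * 'X + b) = map_poly sigma a * 'X + map_poly sigma b.
  by rewrite rmorphD rmorphM /= map_polyX.
by rewrite ScMXaddC !mapE map_polyC ScMXaddC IH map_sigma_sc.
Qed.

Definition sigma2 : {rmorphism P -> P} := sigma \o sigma.

Lemma sigma2E g : sigma2 g = sigma (sigma g).
Proof. by []. Qed.

Lemma map_sigma2_H2 g : map_poly sigma2 (H2 g) = H2 (sigma2 g).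
Proof.
have -> : map_poly sigma2 (H2 g) = map_poly sigma (map_poly sigma (H2 g)).
  by apply: map_poly_comp_id0; rewrite rmorph0.
by rewrite !H2E sigma2E map_sigma_Sc map_sigma_sc map_sigma_Sc map_sigma_sc.
Qed.

(** [sigma2] also multiplies by [z_j^2] the factor [x(z_j)] that [gam] deletes; this [z_j^2]
    survives and joins the weight. *)
Lemma gam_sigma2 p f : gam (map_poly sigma2 p) (sigma2 f) = sigma2 (gam ('X^2 * p) f).
Proof.
move: f p; apply: P_ind => [c|f g IHf IHg|j f IH] p.
- by rewrite sigma2E !sigma_const !gam_const rmorph0.
- by rewrite [sigma2 (f + g)]rmorphD !(raddfD (gam _)) IHf IHg -rmorphD.
rewrite gamY rmorphD -mulrA -mulrA coefXnM -(IH (p * H2 (y j))).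
have mapM a b : map_poly sigma2 (a * b) = map_poly sigma2 a * map_poly sigma2 b by exact: rmorphM.
have gam0 h : gam 0 h = 0 by rewrite -[X in gam X](mul0r 0) -polyC0 gamZ mul0r.
rewrite (mapM p) map_sigma2_H2 [X in gam _ X]rmorphM.
case: j => [|[|j]].
- by rewrite sigma2E !sigma_y /= !rmorph0 mul0r mulr0 gam0 raddf0 addr0.
- by rewrite sigma2E !sigma_y /= !rmorph0 mul0r mulr0 gam0 raddf0 addr0.
rewrite (sigma2E (y _)) !sigma_y /= gamY -map_sigma2_H2 -mapM.
by rewrite coef_map subn2.
Qed.

(** * Degree bounds *)

(* [deg d f]: [f] has degree less than [d] *)
Inductive deg : nat -> P -> Prop :=
| deg0 d : deg d 0
| degC d c : deg d.+1 (iota c)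
| degD d f g : deg d f -> deg d g -> deg d (f + g)
| degY d i f : deg d f -> deg d.+1 (y i * f).

Lemma degS d f : deg d f -> deg d.+1 f.
Proof.
elim=> [{}d|{}d c|{}d f1 g _ IH1 _ IH2|{}d i f1 _ IH];
  [exact: deg0|exact: degC|exact: degD|exact: degY].
Qed.

Lemma deg_leq d e f : (d <= e)%N -> deg d f -> deg e f.
Proof. by move/subnK <-; elim: (e - d)%N => // n IH /IH; exact: degS. Qed.

Lemma deg_inh f : exists d, deg d f.
Proof.
move: f; apply: P_ind => [c|f g [d df] [e eg]|i f [d df]].
- by exists 1%N; exact: degC.
- exists (maxn d e); apply: degD; [apply: deg_leq df|apply: deg_leq eg].
    exact: leq_maxl.
  exact: leq_maxr.
- by exists d.+1; exact: degY.
Qed.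

Lemma deg_eq0 f : deg 0 f -> f = 0.
Proof.
move: {-1}0%N (erefl 0%N) => d d0 df.
by elim: df d0 => // {}d f1 g _ IH1 _ IH2 d0; rewrite IH1 // IH2 // addr0.
Qed.

Lemma degCM d c f : deg d f -> deg d (iota c * f).
Proof.
elim=> [{}d|{}d b|{}d f1 g _ IH1 _ IH2|{}d i f1 _ IH].
- by rewrite mulr0; exact: deg0.
- by rewrite -rmorphM; exact: degC.
- by rewrite mulrDr; exact: degD.
- by rewrite mulrCA; exact: degY.
Qed.

Lemma degB d f g : deg d f -> deg d g -> deg d (f - g).
Proof.
move=> df dg; apply: degD => //; rewrite -mulN1r -(rmorph1 iota) -rmorphN.
exact: degCM.
Qed.

Lemma degM d e f g : deg d f -> deg e.+1 g -> deg (d + e) (f * g).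
Proof.
move=> + dg; elim=> [{}d|{}d c|{}d f1 f2 _ IH1 _ IH2|{}d i f1 _ IH].
- by rewrite mul0r; exact: deg0.
- by apply: degCM; apply: deg_leq dg; rewrite addSn ltnS leq_addl.
- by rewrite mulrDl; exact: degD.
- by rewrite -mulrA addSn; exact: degY.
Qed.

Lemma deg_sum d I (r : seq I) (Q : pred I) (F : I -> P) :
  (forall i, Q i -> deg d (F i)) -> deg d (\sum_(i <- r | Q i) F i).
Proof. by move=> dF; apply: big_ind => //; [exact: deg0|exact: degD]. Qed.

Definition degX d (p : {poly P}) := forall i, deg d p`_i.

Lemma degXM d e p r : degX d p -> degX e.+1 r -> degX (d + e) (p * r).
Proof. by move=> dp dr i; rewrite coefM; apply: deg_sum => j _; apply: degM. Qed.

Lemma degX_y i : degX 2 (y i)%:P.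
Proof.
move=> j; rewrite coefC; case: eqP => _; last exact: deg0.
by rewrite -[y i]mulr1 -(rmorph1 iota); apply/degY/degC.
Qed.

Lemma degX_sc_y i : degX 2 (sc (y i)).
Proof.
rewrite sc_y shC => j; rewrite coefB coefMX; apply: degB.
  by case: i => [|i] /=; [rewrite coef0; exact: deg0|exact: degX_y].
by case: j => [|j] /=; [exact: deg0|exact: degX_y].
Qed.

Lemma degX_sc d f : deg d f -> degX d (sc f).
Proof.
elim=> [{}d|{}d c|{}d f1 g _ IH1 _ IH2|{}d i f1 _ IH].
- by rewrite rmorph0 => j; rewrite coef0; exact: deg0.
- rewrite liftC => j; rewrite /= coefC; case: eqP => _; [exact: degC|exact: deg0].
- by rewrite rmorphD => j; rewrite coefD; apply: degD.
- by rewrite rmorphM mulrC -addn1; apply: degXM => //; exact: degX_sc_y.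
Qed.

Lemma degX_Sc d p : degX d p -> degX d (Sc p).
Proof.
move=> dp; rewrite Sc_sum => i; rewrite coef_sum; apply: deg_sum => j _.
by rewrite coefMXn; case: ifP => _; [exact: deg0|exact: degX_sc].
Qed.

Lemma degX_H2 d f : deg d f -> degX d (H2 f).
Proof. by move=> df; apply/degX_Sc/degX_sc. Qed.

(** One variable is deleted and a coefficient of degree at most [e] takes its place; for [e = 0] the
    degree drops. *)
Lemma deg_gam d e f p : deg d f -> degX e.+1 p -> deg (e + d).-1 (gam p f).
Proof.
move=> df; elim: df e p => [{}d|{}d c|{}d f1 g _ IH1 _ IH2|{}d i f1 df1 IH] e p dp.
- by rewrite raddf0; exact: deg0.
- by rewrite gam_const; exact: deg0.
- by rewrite raddfD; apply: degD; [exact: IH1|exact: IH2].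
rewrite gamY addnS /=; apply: degD.
  by rewrite mulrC addnC; apply: degXM => //; exact: degX_H2.
rewrite -[(e + d)%N]/((e.+1 + d).-1); apply: IH.
by rewrite -[e.+2]addn1 -addSnnS addn0 -[e.+2]addn1; apply: degXM => //; apply/degX_Sc/degX_sc_y.
Qed.

Lemma degX_Xn n : degX 1 'X^n.
Proof.
by move=> i; rewrite coefXn; case: eqP => _; rewrite -?(rmorph1 iota); [exact: degC|exact: deg0].
Qed.

(** * The kernel of [sigma] and the annihilator of [y 0] modulo [J] *)

(* [x(z) |-> (x(z) - x(0)) / z], a section of [sigma] *)
Definition shift : {rmorphism P -> P} := lift iota (y \o succn).

Lemma shift_sigma g : exists a, g = shift (sigma g) + y 0 * a.
Proof.
move: g; apply: P_ind => [c|f g [a fE] [b gE]|i f [a fE]].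
- by exists 0; rewrite sigma_const liftC mulr0 addr0.
- by exists (a + b); rewrite {1}fE {1}gE !rmorphD mulrDr addrACA.
rewrite !rmorphM sigma_y; case: i => [|i] /=.
  by exists f; rewrite rmorph0 mul0r add0r.
by exists (y i.+1 * a); rewrite liftY {1}fE /=; ring.
Qed.

(** [shift] sends [q n] to [q n.+2] minus a multiple of [y 0], so it preserves [J] up to such
    multiples. *)
Lemma J_shift g : J g -> exists2 a, J a & exists b, shift g = a + y 0 * b.
Proof.
elim=> [|f n g' _ [a Ja [b gE]]].
  by exists 0; [exact: J0|exists 0; rewrite rmorph0 mulr0 addr0].
exists (shift f * q n.+2 + a); first by apply: JD => //; exact: Jq.
exists (b - shift f * y n.+2 *+ 2).
have qE : shift (q n) = q n.+2 - y 0 * y n.+2 *+ 2.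
  by rewrite rmorph_q /q -conv_succ; apply: eq_conv => i; exact: liftY.
by rewrite rmorphD rmorphM qE gE; ring.
Qed.

Lemma J_sigma_ker g : J (sigma g) -> exists a, J (g - y 0 * a).
Proof.
have [a {2}->] := shift_sigma g.
move=> /J_shift [h Jh [b ->]]; exists (b + a).
by have -> : h + y 0 * b + y 0 * a - y 0 * (b + a) = h by ring.
Qed.

(** A converse to the key fact: modulo [J], [g] lies in the ideal of [y 0] and [y 1], while
    [y 0 * y 0] is [q 0] and [y 0 * y 1] is half of [q 1]. *)
Lemma J_sigma2_ker g : J (sigma2 g) -> J (y 0 * g).
Proof.
rewrite sigma2E => /J_sigma_ker [a Ja].
have [b gE] := shift_sigma g; have [h Jh [c hE]] := J_shift Ja.
have {}gE : g = h + y 1 * shift a + y 0 * (c + b).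
  rewrite gE -[sigma g](subrK (y 0 * a)) rmorphD rmorphM hE liftY /=; ring.
have J00 : J (y 0 * y 0) by have := Jqn 0; rewrite /q /conv big_ord1.
have J01 : J (y 0 * y 1).
  apply: (@JMn_inv _ 1); have := Jqn 1; rewrite /q /conv !big_ord_recr big_ord0 /=.
  by rewrite add0r [y 1 * _]mulrC.
have -> : y 0 * g = y 0 * h + shift a * (y 0 * y 1) + (c + b) * (y 0 * y 0).
  by rewrite gE; ring.
by apply/JD/JM/J00; apply: JD; [exact: JM|exact/JM/J01].
Qed.

Lemma gam_comm g : gam 1 (sigma2 g) = sigma2 (gam 'X^2 g).
Proof. by have := gam_sigma2 1 g; rewrite rmorph1 mulr1. Qed.

Local Notation gam2 := (gam 'X^2).

(** Apply [gam 1] repeatedly: [gam_comm] advances the [sigma2] term, and [gam_y0] extracts one more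
    copy of it from the [y 0] term, hence the multiplicity. *)
Lemma J_gam_iter g n : J (y 0 * g) ->
  J (sigma2 (iter n gam2 g) *+ n.+1 + y 0 * iter n.+1 gam2 g).
Proof.
move=> Jg; elim: n => [|n IH]; first by rewrite mulr1n -gam_y0; exact: J_gam.
have := J_gam 1 IH; rewrite raddfD raddfMn /= gam_comm gam_y0 addrA.
by rewrite -iterS -mulrSr.
Qed.

(* With [g_n := iter n gam2 g], [J_gam_iter] reduces [sigma2 g_n] to [y 0 * g_(n+1)]; as [gam2] lowers
   the degree, descend from [g_n = 0], going back from [sigma2 g_n] to [y 0 * g_n] by [J_sigma2_ker]. *)
Lemma J_ann_y0 g : J (y 0 * g) -> J (sigma2 g).
Proof.
move=> Jg.
have step n : J (y 0 * iter n.+1 gam2 g) -> J (sigma2 (iter n gam2 g)).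
  by move=> Jn; apply: (@JMn_inv _ n); have := JB (J_gam_iter n Jg) Jn; rewrite addrK.
have [d dg] := deg_inh g.
have dn n : deg (d - n) (iter n gam2 g).
  elim: n => [|n IH]; first by rewrite subn0.
  by rewrite iterS subnS; apply: (@deg_gam _ 0%N) => //; exact: degX_Xn.
have g0 : iter d gam2 g = 0 by apply: deg_eq0; have := dn d; rewrite subnn.
apply: (step 0%N); have : J (y 0 * iter d.+1 gam2 g) by rewrite iterS g0 raddf0 mulr0; exact: J0.
by elim: d {dg dn g0} => // d IH /step /J_sigma2_ker; exact: IH.
Qed.

(** * Homogeneous components and truncation *)

Definition grade : {rmorphism P -> {poly P}} := lift (polyC \o iota) (fun i => (y i)%:P * 'X).
(** The witness of [J_sigma_ker] comes with no degree bound; truncating it restores one, and [J] is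
    stable because it is homogeneous. *)
Definition trunc d (g : P) : P := \sum_(i < d) (grade g)`_i.

Lemma trunc_sub d f g : trunc d (f - g) = trunc d f - trunc d g.
Proof. by rewrite /trunc -sumrB; apply: eq_bigr => i _; rewrite rmorphB coefB. Qed.

Lemma truncD d f g : trunc d (f + g) = trunc d f + trunc d g.
Proof. by rewrite /trunc -big_split; apply: eq_bigr => i _; rewrite rmorphD coefD. Qed.

Lemma gradeY i f : grade (y i * f) = (y i)%:P * grade f * 'X.
Proof. by rewrite rmorphM liftY /= mulrAC. Qed.

Lemma truncY d i f : trunc d.+1 (y i * f) = y i * trunc d f.
Proof.
rewrite /trunc gradeY big_ord_recl coefMX /= add0r mulr_sumr.
by apply: eq_bigr => j _; rewrite coefMX coefCM.
Qed.

Lemma J_grade g : J g -> JX (grade g).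
Proof.
apply: JX_rmorph => n; rewrite rmorph_q.
rewrite (@eq_conv _ _ (fun i => (y i)%:P * 'X) _ (fun i => (y i)%:P * 'X)); try exact: liftY.
rewrite convMl convMr mulrC; apply: JXM; rewrite mulrC; apply: JXM.
have -> : conv (fun i => (y i)%:P) (fun i => (y i)%:P) n = (q n)%:P.
  by rewrite /q /conv rmorph_sum; apply: eq_bigr => i _; rewrite rmorphM.
exact/JXC/Jqn.
Qed.

Lemma J_trunc d g : J g -> J (trunc d g).
Proof. by move=> Jg; apply: J_sum => i _; exact: J_grade. Qed.

Lemma trunc_id d f : deg d f -> trunc d f = f.
Proof.
elim=> [{}d|{}d c|{}d f1 g _ IH1 _ IH2|{}d i f1 _ IH].
- by rewrite /trunc rmorph0 big1 // => i _; rewrite coef0.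
- rewrite /trunc liftC big_ord_recl coefC /= big1 ?addr0 // => i _.
  by rewrite coefC.
- by rewrite truncD IH1 IH2.
- by rewrite truncY IH.
Qed.

Lemma deg_grade g i : deg i.+1 (grade g)`_i.
Proof.
move: g i; apply: P_ind => [c|f g IHf IHg|j f IH] i.
- by rewrite liftC coefC; case: eqP => [->|_]; [exact: degC|exact: deg0].
- by rewrite rmorphD coefD; apply: degD.
- rewrite gradeY coefMX; case: i => [|i] /=; first exact: deg0.
  by rewrite coefCM; apply: degY.
Qed.

Lemma deg_trunc d g : deg d (trunc d g).
Proof. by apply: deg_sum => i _; apply: deg_leq (deg_grade g i). Qed.

(** * Primeness of [J] *)

Lemma deg_sigma d f : deg d f -> deg d (sigma f).
Proof.
elim=> [{}d|{}d c|{}d f1 g _ IH1 _ IH2|{}d i f1 _ IH].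
- by rewrite rmorph0; exact: deg0.
- by rewrite sigma_const; exact: degC.
- by rewrite rmorphD; exact: degD.
- rewrite rmorphM sigma_y; case: i => [|i] /=; first by rewrite mul0r; exact: deg0.
  exact: degY.
Qed.

Lemma iter_sigmaM n f g : iter n sigma (f * g) = iter n sigma f * iter n sigma g.
Proof. by elim: n => //= n ->; rewrite rmorphM. Qed.

(** [i + 1] steps kill [y i]. The claim covers all later iterates so that the bounds for two
    summands can be added. *)
Lemma iter_sigma_const g : exists c n, forall m, iter (m + n) sigma g = iota c.
Proof.
have iterA n f h : iter n sigma (f + h) = iter n sigma f + iter n sigma h.
  by elim: n => //= n ->; rewrite rmorphD.
have iter0 n : iter n sigma 0 = 0 by elim: n => //= n ->; rewrite rmorph0.
move: g; apply: P_ind => [c|f g [a [n fE]] [b [m gE]]|i f _].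
- by exists c, 0%N => m; rewrite addn0; elim: m => //= m ->; rewrite sigma_const.
- exists (a + b), (n + m)%N => l; rewrite iterA rmorphD.
  by rewrite {1}(addnC n) addnA fE addnA gE.
- exists 0, i.+1 => m; rewrite rmorph0 iter_sigmaM.
  have -> : iter (m + i.+1) sigma (y i) = 0; last by rewrite mul0r.
  by rewrite iterD; elim: i => [|i IH]; rewrite iterSr sigma_y ?iter0.
Qed.

(** [m] counts the applications of [sigma] already made to the derivatives of [b]; it grows as the
    degree of [a] drops. *)
Lemma J_prime_deg d m a b : deg d a ->
  (forall n, J (a * iter m sigma (iter n D b))) -> ~ J a -> J b.
Proof.
elim: d m a => [|d IH] m a da Jab nJa.
  by case: nJa; rewrite (deg_eq0 da); exact: J0.
have Jab_sigma l n : J (iter l sigma a * iter (l + m) sigma (iter n D b)).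
  rewrite iterD -iter_sigmaM; elim: l => [|l IHl]; [exact: Jab|exact: J_sigma].
(* Either the iterates of [a] enter [J] after some step [l], or they never do and their eventual
   constant value is nonzero. *)
have [[l [nJl Jl]]|no_drop] :=
  classic (exists l, ~ J (iter l sigma a) /\ J (iter l.+1 sigma a)); last first.
  have nJ l : ~ J (iter l sigma a).
    elim: l => [//|l nJl] Jl; case: no_drop; exists l; by split.
  have [c [l aE]] := iter_sigma_const a.
  have {}aE : iter l sigma a = iota c by have := aE 0%N.
  have c0 : c != 0 by apply/eqP => c0; apply: (nJ l); rewrite aE c0 rmorph0; exact: J0.
  apply: (@J_iter_sigma_D (l + m)) => n; apply: (JC c0); rewrite -aE; exact: Jab_sigma.
have [a' Ja'] := J_sigma_ker Jl.
have dl : deg d.+1 (iter l sigma a) by elim: l {nJl Jl Ja'} => //= l /deg_sigma.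
(* Truncating [a'] keeps the congruence, as the iterate of [a] has degree at most [d]. *)
have {Ja'} Ja' : J (iter l sigma a - y 0 * trunc d a').
  by have := J_trunc d.+1 Ja'; rewrite trunc_sub (trunc_id dl) truncY.
apply: (IH (l + m).+2 (sigma2 (trunc d a'))); first by do 2!apply: deg_sigma; exact: deg_trunc.
  move=> n; rewrite !iterS -[X in _ * X]sigma2E -rmorphM; apply: J_ann_y0.
  have -> : y 0 * (trunc d a' * iter (l + m) sigma (iter n D b)) =
      iter l sigma a * iter (l + m) sigma (iter n D b) -
      iter (l + m) sigma (iter n D b) * (iter l sigma a - y 0 * trunc d a') by ring.
  by apply: JB => //; apply: JM.
(* Otherwise [y 0 * trunc d a'], and with it the iterate of [a], would lie in [J]. *)
move=> /J_sigma2_ker J0a'; apply: nJl.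
by rewrite -(subrK (y 0 * trunc d a') (iter l sigma a)); apply: JD.
Qed.

Lemma J_prime a b : (forall n, J (a * iter n D b)) -> ~ J a -> J b.
Proof. by move=> Jab nJa; have [d da] := deg_inh a; apply: (@J_prime_deg d 0 a). Qed.

End FreeDifferential.

(** * Differential ideals of [k_+{x}] *)

Section DifferentialIdeal.
Variable k : fieldType.
Hypothesis char0 : [pchar k] =i pred0.
Local Notation P := {malg k[{cmonom nat}]}.
Local Notation y := (@yv k).

Definition dconst : {rmorphism k -> P} := @malgC {cmonom nat} k.
Definition dlift (S : comNzRingType) (phi : {rmorphism k -> S}) (v : nat -> S) :
  {rmorphism P -> S} := dsubst phi v.
Definition dgder (psi : nat -> {additive P -> P}) : {additive P -> P} := gder psi.

Lemma dconst_ind (Q : P -> Prop) :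
  (forall c, Q (dconst c)) -> (forall f g, Q f -> Q g -> Q (f + g)) ->
  (forall i f, Q f -> Q (y i * f)) -> forall g, Q g.
Proof. exact: dpoly_ind. Qed.

Lemma dliftC S phi v c : @dlift S phi v (dconst c) = phi c.
Proof. exact: dsubstC. Qed.

Lemma dliftY S phi v i : @dlift S phi v (y i) = v i.
Proof. exact: dsubstY. Qed.

Lemma dgderC psi c : dgder psi (dconst c) = 0.
Proof. exact: gderC. Qed.

Lemma dgderY psi j f : dgder psi (y j * f) = psi j f + dgder (premul psi (y j)) f.
Proof. exact: gderY. Qed.

Lemma dderivE (g : P) : dderiv g = D y dgder g.
Proof.
rewrite /dderiv; apply: eq_bigr => m _; move: (g@_m) => c.
rewrite /dmon scaler_sumr; apply: eq_bigr => i _.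
rewrite /= /dpsi scalerA malgZU mulr1.
have -> : y i.+1 = (i.+1`!%:R)^-1 *: << ucm i.+1 >> by [].
rewrite malgZU malgUMU mulr1 -mulrnA -monalgUMn.
have -> : (i.+1`!%:R)^-1 * c *+ (i.+1 * (m i * i`!)) = c * (m i)%:R.
  rewrite mulnCA -factS -mulr_natr natrM [(m i)%:R * _]mulrC mulrACA.
  by rewrite mulVf ?(factr_neq0 char0) // mul1r.
by have -> : mulcm (divcm m (ucm i)) (ucm i.+1) = mmul (ucm i.+1) (divcm m (ucm i)) by exact: mulcmC.
Qed.

Lemma kplusD (f g : P) : kplus f -> kplus g -> kplus (f + g).
Proof. by rewrite /kplus mcoeffD => -> ->; rewrite addr0. Qed.

Lemma kplusM (f g : P) : kplus g -> kplus (f * g).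
Proof.
have e : {morph (@mcoeff _ k (onecm nat)) : f g / f * g} := (mcoeff1g_is_multiplicative _ _).1.
by rewrite /kplus e => ->; rewrite mulr0.
Qed.

Lemma kplus_y i : kplus (y i).
Proof.
have m1 : (ucm i == onecm nat) = false by exact: cm1_eq1.
by rewrite /kplus mcoeffZ mcoeffU m1 mulr0n mulr0.
Qed.

Lemma kplus_J (g : P) : J y g -> kplus g.
Proof.
elim=> [|f n g' _ IH]; first exact: mcoeff0.
apply: kplusD => //; apply: kplusM; rewrite /q /conv.
apply: (big_ind (fun g : P => kplus g)); [exact: mcoeff0|exact: kplusD|].
by move=> i _; apply: kplusM; exact: kplus_y.
Qed.

Lemma q0 : q y 0 = xvar k 0 ^+ 2.
Proof.
rewrite /q /conv big_ord1 expr2.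
by have -> : y 0 = xvar k 0 by rewrite /yv fact0 invr1 scale1r.
Qed.

Lemma D_q_dpoly n : D y dgder (q y n) = q y n.+1 *+ n.+1.
Proof. exact: (D_q dconst_ind dgderC dgderY). Qed.

Lemma diff_ideal_J : diff_ideal (fun g : dpoly k => J y g).
Proof.
split=> [g|]; first exact: kplus_J.
split; [exact: J0|exact: JD|move=> c f|by move=> f g _; exact: JM|].
  by rewrite -mul_malgC; exact: JM.
by move=> f; rewrite dderivE; exact: (J_D dconst_ind dgderC dgderY).
Qed.

Lemma X2P (g : dpoly k) : X2 g <-> J y g.
Proof.
split=> [|Jg I HI I0]; first by apply; [exact: diff_ideal_J|rewrite -q0; exact: Jqn].
have [Ik [I00 ID IZ IM IDer]] := HI.
have Iq n : I (q y n).
  elim: n => [|n IH]; first by rewrite q0.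
  (* Characteristic zero recovers [q n.+1] from the derivative of [q n]. *)
  have -> : q y n.+1 = (n.+1%:R)^-1 *: dderiv (q y n).
    rewrite dderivE D_q_dpoly -scaler_nat scalerA mulVf ?scale1r //.
    exact: natr_neq0.
  exact/IZ/IDer.
have Ifq f n : I (f * q y n).
  (* [I] absorbs only factors without constant term, so the constant term of [f] is split off and
     acts as a scalar. *)
  rewrite -[f](subrK (dconst f@_(onecm nat))) mulrDl.
  have -> : dconst f@_(onecm nat) * q y n = f@_(onecm nat) *: q y n by exact: mul_malgC.
  apply: ID; last exact: (IZ _ _ (Iq n)).
  by apply: (IM _ _ _ (Iq n)); rewrite /kplus mcoeffB mcoeffUU subrr.
by elim: Jg => [|f n g' _ Ig']; [exact: I00|exact: (ID _ _ (Ifq f n) Ig')].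
Qed.

End DifferentialIdeal.

Unset Implicit Arguments.

(* Differential ideals of D_2 = k_+{x}/[x^2] are represented by their
   preimages in k_+{x}: differential ideals A of k_+{x} containing [x^2].
   Such an ideal is nonzero in D_2 iff A is not contained in [x^2], and the
   product ideal AB of D_2 is nonzero iff some product a*b (a in A, b in B)
   is not in [x^2]. *)
Theorem theorem1 (k : fieldType) (char0 : [pchar k] =i pred0)
    (A B : dpoly k -> Prop) :
  diff_ideal A -> diff_ideal B ->
  (forall g, X2 g -> A g) -> (forall g, X2 g -> B g) ->
  (exists a, A a /\ ~ X2 a) -> (exists b, B b /\ ~ X2 b) ->
  exists a b, [/\ A a, B b & ~ X2 (a * b)].
Proof.
move=> _ [_ [_ _ _ _ DB]] _ _ [a [Aa nXa]] [b [Bb nXb]].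
(* If every product lies in [[x^2]], so do all [a b^(n)], as [B] is closed under the derivation;
   then [J_prime] applies. *)
apply: NNPP => no_ab; apply: nXb; apply/(X2P char0).
have nJa : ~ J (@yv k) a by move/(X2P char0).
apply: (J_prime char0 (@dconst_ind _ char0) (@dliftC k) (dliftY char0)
  (@dgderC k) (dgderY char0) _ nJa) => n.
apply/(X2P char0); apply: NNPP => nX; apply: no_ab.
exists a, (iter n (D (@yv k) (@dgder k)) b); split=> //.
by elim: n {nX} => [//|n IH]; rewrite iterS -dderivE //; exact: DB.
Qed.
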